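(* For each positive integer $n$ there exists a cubic graph $H$ with $l(H)=n$.
   Context: Graphs may contain parallel edges but no loops. A graph is Class I if its chromatic index equals its maximum degree. For (not necessarily distinct) edge sets $N_1,\dots,N_t\subseteq E(H)$, $H+N_1+\dots+N_t$ denotes the multigraph obtained from $H$ by adding to every edge $e$ of $H$ a number of parallel edges equal to the number of indices $i$ with $e\in N_i$. The parameter $l(H)$ is the minimum integer $k\ge 0$ for which there exist perfect matchings $M_1,\dots,M_k$ of $H$ (repetitions allowed) such that $H+M_1+\dots+M_k$ is Class I; $l(H)=+\infty$ if no such $k$ exists. *)

(* Defs.v *)
From mathcomp Require Import all_boot.
From mathcomp Require Import boolp.

Set Implicit Arguments.
Unset Strict Implicit.
Unset Printing Implicit Defensive.

(* Finite loopless multigraphs: [ends] need not be injective, so parallel edges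
   are allowed, and an edge has two distinct ends. *)
Record multigraph := Multigraph {
  vertex : finType;
  edge : finType;
  ends : edge -> {set vertex};
  card_ends : forall e, #|ends e| = 2 }.

Definition degree (G : multigraph) (v : vertex G) : nat :=
  #|[set e : edge G | v \in ends e]|.

Definition max_degree (G : multigraph) : nat := \max_(v : vertex G) degree v.

Definition cubic (G : multigraph) : Prop := forall v : vertex G, degree v = 3.

Definition adjacent_edges (G : multigraph) (e f : edge G) : bool :=
  (e != f) && (ends e :&: ends f != set0).

Definition edge_colorable (G : multigraph) (k : nat) : bool :=
  [exists c : {ffun edge G -> 'I_k},
    forall e, forall f, adjacent_edges e f ==> (c e != c f)].

Lemma ex_edge_colorable (G : multigraph) : exists k, edge_colorable G k.
Proof.
exists #|edge G|; apply/existsP; exists [ffun e => enum_rank e].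
apply/forallP => e; apply/forallP => f; apply/implyP => /andP[nef _].
by rewrite !ffunE (inj_eq enum_rank_inj).
Qed.

Definition chromatic_index (G : multigraph) : nat :=
  ex_minn (ex_edge_colorable G).

Definition classI (G : multigraph) : bool := chromatic_index G == max_degree G.

Definition perfect_matching (G : multigraph) (M : {set edge G}) : bool :=
  [forall v : vertex G, #|[set e in M | v \in ends e]| == 1].

(* Besides the old edges, there is one new edge for each pair (i, e) with
   e \in N i, parallel to e. *)
Definition add_edge (G : multigraph) (t : nat) (N : 'I_t -> {set edge G}) :
    finType :=
  (edge G + {p : 'I_t * edge G | p.2 \in N p.1})%type.

Definition add_ends (G : multigraph) (t : nat) (N : 'I_t -> {set edge G})
    (x : add_edge N) : {set vertex G} :=
  match x with inl e => ends e | inr p => ends (val p).2 end.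

Lemma card_add_ends (G : multigraph) (t : nat) (N : 'I_t -> {set edge G})
    (x : add_edge N) : #|add_ends x| = 2.
Proof. by case: x => ?; apply: card_ends. Qed.

Definition add_edge_sets (G : multigraph) (t : nat)
    (N : 'I_t -> {set edge G}) : multigraph :=
  Multigraph (@card_add_ends G t N).

Definition classI_after (H : multigraph) (k : nat) : bool :=
  [exists M : {ffun 'I_k -> {set edge H}},
    [forall i, perfect_matching (M i)] && classI (add_edge_sets M)].

(* The parameter l, with values in the naturals extended by +oo, which is
   represented by None. *)
Definition l (H : multigraph) : option nat :=
  match pselect (exists k, classI_after H k) with
  | left ex => Some (ex_minn ex)
  | right _ => None
  end.

(* Main.v *)
(* Since H + M_1 + ... + M_k is (k+3)-regular, it is Class I if and only if
   1 + sum_i M_i is a sum of k+3 perfect matchings of H, identifying edge sets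
   with their indicator vectors.

   Take vertices a_0, ..., a_{n-1} and r_0, ..., r_{n+1}, edges a_i r_{i+c} for
   c = 0, 1, 2, and the edges r_n r_{n+1}, r_0 r_{n+1}, r_0 r_1; then replace
   every a_i by a Petersen graph minus a vertex.  A perfect matching M uses one
   or three of the edges leaving the i-th Petersen part.  Some three edges of this
   part meet every M of the former kind in an even number of edges, so by parity
   some M_j must use all three edges leaving part i.  As there are only n+2
   vertices r_t, no matching does so at two parts, hence k >= n.  For k = n, let
   M_i use the three edges from part i to r_i, r_{i+1}, r_{i+2}, and join part j
   to r_j for j < i and to r_{j+2} for j > i. *)
Require Import Defs.
From mathcomp Require Import all_boot zify.

Set Implicit Arguments.
Unset Strict Implicit.
Unset Printing Implicit Defensive.

Lemma eq_leq_sum (I : finType) (f g : I -> nat) :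
  (forall i, f i <= g i) -> \sum_i f i = \sum_i g i -> f =1 g.
Proof.
move=> le_fg eq_fg i; apply/eqP.
have [_] := @leqif_sum _ predT _ f g (fun j _ => leqif_eq (le_fg j)).
by rewrite eq_fg eqxx => /esym/forallP/(_ i).
Qed.

Lemma leq1_sum_bool (I : finType) (P : pred I) :
  (forall i j, P i -> P j -> i = j) -> \sum_i P i <= 1.
Proof.
move=> injP; rewrite -big_mkcond sum1_card.
by apply/card_le1_eqP => i j Pi Pj; apply: injP.
Qed.

(** * Class I for regular multigraphs *)

Section RegularGraphs.

Variable G : multigraph.

Lemma degreeE (v : vertex G) : degree v = \sum_e (v \in ends e).
Proof. by rewrite /degree cardsE -sum1_card big_mkcond. Qed.

Lemma perfect_matchingP (M : {set edge G}) :
  reflect (forall v, \sum_e (e \in M) * (v \in ends e) = 1)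
          (perfect_matching M).
Proof.
have cE v : #|[set e in M | v \in ends e]| = \sum_e (e \in M) * (v \in ends e).
  rewrite -sum1dep_card big_mkcond; apply: eq_bigr => e _.
  by rewrite mulnb; case: ifP.
by apply: (iffP forallP) => pmM v; have := pmM v; rewrite cE => /eqP.
Qed.

Lemma degree_leq_colors m (v : vertex G) : edge_colorable G m -> degree v <= m.
Proof.
case/existsP => c /forallP c_ok; rewrite -[m in _ <= m]card_ord.
have c_inj : {in [set e | v \in ends e] &, injective c}.
  move=> e f; rewrite !inE => ve vf /eqP eq_c; apply: contraTeq eq_c => nef.
  move/forallP/(_ f)/implyP: (c_ok e); apply; rewrite /adjacent_edges nef.
  by apply/set0Pn; exists v; rewrite inE ve.
by rewrite /degree -(card_in_imset c_inj) max_card.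
Qed.

(** The vertex [v0] keeps the maximum degree from being an empty maximum; the edges at [v0] already
    force [k] colours. *)
Lemma classI_regular k (v0 : vertex G) :
  (forall v : vertex G, degree v = k) -> classI G = edge_colorable G k.
Proof.
move=> regG; have -> : classI G = (chromatic_index G == k).
  rewrite /classI; congr (_ == _); apply/eqP; rewrite eqn_leq -{2}(regG v0).
  rewrite leq_bigmax andbT; apply/bigmax_leqP => v _; by rewrite regG.
rewrite /chromatic_index; case: ex_minnP => m col_m min_m.
apply/eqP/idP => [<- // | col_k]; apply/eqP; rewrite eqn_leq min_m //=.
by rewrite -(regG v0) degree_leq_colors.
Qed.

End RegularGraphs.

(** * Colourings after adding matchings, as families of perfect matchings *)

Section AddEdgeSets.

Variables (G : multigraph) (k : nat) (M : 'I_k -> {set edge G}).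

Definition base_edge (x : edge (add_edge_sets M)) : edge G :=
  match x with inl e => e | inr p => (val p).2 end.

Lemma ends_base_edge (x : edge (add_edge_sets M)) : ends x = ends (base_edge x).
Proof. by case: x. Qed.

Lemma sum_add_edge_sets (F : edge G -> nat) :
  \sum_x F (base_edge x) = \sum_e (1 + \sum_i (e \in M i)) * F e.
Proof.
rewrite big_sumType /=.
rewrite -(@big_sub _ _ _ _ [pred p : 'I_k * edge G | p.2 \in M p.1] (fun p => F p.2)).
under [RHS]eq_bigr do rewrite mulnDl mul1n.
rewrite big_split /=; congr (_ + _).
under [RHS]eq_bigr do rewrite big_distrl.
rewrite exchange_big pair_big big_mkcond; apply: eq_bigr => p _ /=.
by rewrite inE; case: (_ \in _); rewrite ?mul1n.
Qed.

Lemma degree_add_edge_sets (v : vertex G) :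
  (forall i, perfect_matching (M i)) ->
  @degree (add_edge_sets M) v = degree v + k.
Proof.
move=> pmM; rewrite !degreeE.
under eq_bigr do rewrite ends_base_edge.
rewrite (sum_add_edge_sets (fun e => v \in ends e)).
under eq_bigr do rewrite mulnDl mul1n big_distrl.
rewrite big_split exchange_big /=; congr (_ + _).
rewrite (eq_bigr (fun => 1)) ?sum1_card ?card_ord // => i _.
exact/perfect_matchingP.
Qed.

(** Each colour class projects to a perfect matching of [G]. Conversely, an edge [e] has as many
    copies as there are indices [j] with [e] in [N j], so these indices can serve as the colours of
    the copies. *)
Lemma classI_add_edge_sets (v0 : vertex G) :
    cubic G -> (forall i, perfect_matching (M i)) ->
  classI (add_edge_sets M) <->
  exists2 N : 'I_(3 + k) -> {set edge G}, forall j, perfect_matching (N j) &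
    forall e, \sum_j (e \in N j) = 1 + \sum_i (e \in M i).
Proof.
move=> cubG pmM.
have regM v : @degree (add_edge_sets M) v = 3 + k.
  by rewrite degree_add_edge_sets // cubG.
rewrite (classI_regular (v0 : vertex (add_edge_sets M)) regM).
have fiber_sum e : \sum_x (base_edge x == e) = 1 + \sum_i (e \in M i).
  rewrite (sum_add_edge_sets (fun f => f == e)) (bigD1 e) //= eqxx muln1.
  rewrite -[RHS]addn0; congr (_ + _).
  by apply: big1 => f /negPf->; rewrite muln0.
split=> [/existsP[c /forallP c_ok] | [N pmN sumN]].
  have c_inj v x y : v \in ends (base_edge x) -> v \in ends (base_edge y) ->
      c x = c y -> x = y.
    move=> vx vy /eqP eq_c; apply: contraTeq eq_c => nxy.
    move/forallP/(_ y)/implyP: (c_ok x); apply; rewrite /adjacent_edges nxy.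
    by apply/set0Pn; exists v; rewrite inE !ends_base_edge vx.
  pose N j := [set e | [exists x, (base_edge x == e) && (c x == j)]].
  (* Copies of [e] share their ends, so at most one of them has colour [j], and membership can be
     written as a count. *)
  have N_E j e : (e \in N j) = \sum_x (base_edge x == e) * (c x == j) :> nat.
    under eq_bigr do rewrite mulnb.
    apply/eqP; rewrite inE eqn_leq; apply/andP; split.
      by case: existsP => // -[x ex]; rewrite (bigD1 x) //= ex.
    case: existsP => [_ | no_x]; last first.
      by rewrite big1 // => x _; case: andP => // /andP ex; case: no_x; exists x.
    apply: leq1_sum_bool => x y /andP[/eqP<- /eqP<-] /andP[/eqP exy /eqP cxy].
    have [v ve] : exists v, v \in ends (base_edge x).
      by apply/card_gt0P; rewrite card_ends.
    by apply: (c_inj v); rewrite ?exy.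
  have pmN_le1 j v : \sum_e (e \in N j) * (v \in ends e) <= 1.
    under eq_bigr do rewrite N_E big_distrl.
    rewrite exchange_big /=.
    rewrite (eq_bigr (fun x => ((v \in ends (base_edge x)) && (c x == j)) : nat)).
      apply: leq1_sum_bool => x y /andP[vx /eqP<-] /andP[vy /eqP cxy].
      exact: (c_inj v).
    move=> x _; rewrite (bigD1 (base_edge x)) //= eqxx mul1n mulnb andbC.
    by rewrite big1 ?addn0 // => e /negPf ne; rewrite eq_sym ne.
  have sum_c x : \sum_j (c x == j) = 1.
    by rewrite (bigD1 (c x)) //= eqxx big1 // => j /negPf; rewrite eq_sym => ->.
  have N_sum e : \sum_j (e \in N j) = 1 + \sum_i (e \in M i).
    under eq_bigr do rewrite N_E.
    rewrite exchange_big /= -fiber_sum; apply: eq_bigr => x _.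
    by rewrite -big_distrr /= sum_c muln1.
  exists N => // j; apply/perfect_matchingP => v.
  (* Each colour occurs at most once at [v], and the [3 + k] edges at [v] use [3 + k] colours in
     all, so each occurs exactly once. *)
  move: j; apply: (@eq_leq_sum _ _ (fun=> 1)) => [j|]; first exact: pmN_le1.
  have <- : @degree (add_edge_sets M) v = \sum_(j < 3 + k) 1.
    by rewrite sum1_card card_ord.
  rewrite exchange_big degreeE.
  under [RHS]eq_bigr do rewrite ends_base_edge.
  rewrite (sum_add_edge_sets (fun e => v \in ends e)).
  by apply: eq_bigr => e _; rewrite -big_distrl /= N_sum.
pose copies x := [set y | base_edge y == base_edge x].
pose colors x := [set j | base_edge x \in N j].
have card_eq x : #|colors x| = #|copies x|.
  have := sumN (base_edge x); rewrite -fiber_sum => sum_eq.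
  by rewrite -!sum1dep_card [LHS]big_mkcond [RHS]big_mkcond.
have j0 : 'I_(3 + k) := ord0.
(* The copy of rank r takes the r-th index [j] with [base_edge x] in [N j]; both lists have the same
   length, so the default [j0] is never reached. *)
pose c x := nth j0 (enum (colors x)) (index x (enum (copies x))).
have copies_refl x : x \in enum (copies x) by rewrite mem_enum inE.
have c_lt x : index x (enum (copies x)) < size (enum (colors x)).
  by rewrite -cardE card_eq cardE index_mem.
have cN x : base_edge x \in N (c x).
  by have := mem_nth j0 (c_lt x); rewrite mem_enum inE.
apply/existsP; exists [ffun x => c x]; apply/forallP => x; apply/forallP => y.
rewrite !ffunE; apply/implyP => /andP[nxy /set0Pn[v]].
rewrite inE !ends_base_edge => /andP[vx vy]; apply: contra nxy => /eqP eq_c.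
(* The matching [N (c x)] has only one edge at [v]. *)
have eq_b : base_edge x = base_edge y.
  have /perfect_matchingP/(_ v) := pmN (c x).
  apply: contra_eq => nb; rewrite (bigD1 (base_edge x)) //=.
  rewrite (bigD1 (base_edge y)) 1?eq_sym //= cN vx eq_c cN vy.
  by rewrite addnA.
move: eq_c; rewrite /c; have -> : colors x = colors y by rewrite /colors eq_b.
have eq_cop : copies x = copies y by rewrite /copies eq_b.
move/eqP; rewrite nth_uniq ?enum_uniq //; last first.
  by have := c_lt x; rewrite [colors x]/colors eq_b.
rewrite eq_cop => /eqP eq_i.
rewrite -(nth_index x (copies_refl y)) -eq_i nth_index //.
by rewrite -eq_cop.
Qed.

End AddEdgeSets.

(** Turns a bounded universal statement into a single boolean that can be evaluated. *)
Lemma all_iota0 (P : pred nat) m : all P (iota 0 m) -> forall x, x < m -> P x.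
Proof. by move=> /allP allP x lt_xm; apply: allP; rewrite mem_iota. Qed.

Lemma sum_iota0 (F : nat -> nat) m :
  \sum_(0 <= c < m) F c = sumn [seq F c | c <- iota 0 m].
Proof. by rewrite sumnE big_map /index_iota subn0. Qed.

(** * The chain of Petersen parts and its incidence sums *)

Section ChainGraph.

Variable n : nat.

Definition chain_vertex : finType := ('I_n * 'I_9 + 'I_n.+2)%type.
Definition chain_edge : finType := ('I_n * 'I_15 + 'I_3)%type.

(* In a Petersen graph minus a vertex, the vertices 0, 1, 2 are the neighbours of
   the deleted vertex and 3, ..., 8 form the 6-cycle.  The edges 0, 1, 2 leave
   the part, 3, ..., 8 join the two kinds of vertices, and 9, ..., 14 are those
   of the 6-cycle.  [inner_end2] is meaningless at 0, 1, 2. *)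
Definition inner_end1 (c : nat) : nat := if c < 9 then c %% 3 else c - 6.
Definition inner_end2 (c : nat) : nat := if c < 9 then c else 3 + (c - 8) %% 6.
(** The Petersen parts leave r_0 and r_{n+1} two edges short of degree 3, and r_1 and r_n one edge
    short each (two if they coincide); the three outer edges make up for this. *)
Definition outer_end1 (d : nat) : nat := if d == 0 then n else 0.
Definition outer_end2 (d : nat) : nat := if d == 2 then 1 else n.+1.

Definition chain_end1 (e : chain_edge) : chain_vertex :=
  match e with
  | inl p => inl (p.1, inord (inner_end1 p.2))
  | inr d => inr (inord (outer_end1 d))
  end.

Definition chain_end2 (e : chain_edge) : chain_vertex :=
  match e with
  | inl p => if p.2 < 3 then inr (inord (p.1 + p.2))
             else inl (p.1, inord (inner_end2 p.2))
  | inr d => inr (inord (outer_end2 d))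
  end.

Lemma inner_end_lt c : c < 15 ->
  [&& inner_end1 c < 9, (2 < c) ==> (inner_end2 c < 9)
    & (2 < c) ==> (inner_end1 c != inner_end2 c)].
Proof.
by move: c; apply: all_iota0.
Qed.

Lemma outer_end_lt d : (outer_end1 d < n.+2) && (outer_end2 d < n.+2).
Proof. by rewrite /outer_end1 /outer_end2; do 2!case: ifP => _; lia. Qed.

Lemma card_chain_ends e : #|[set chain_end1 e; chain_end2 e]| = 2.
Proof.
rewrite cards2; case: eqP => //; case: e => [[i c] | d] /=.
  case: ltnP => // c_ge3 [] /(congr1 val) /=.
  have /and3P[lt1] := inner_end_lt (ltn_ord c).
  by rewrite c_ge3 /= => lt2 /eqP ne; rewrite !inordK.
have /andP[lt1 lt2] := outer_end_lt d.
case=> /(congr1 val) /=; rewrite !inordK // /outer_end1 /outer_end2.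
by have := ltn_ord d; do 2!case: ifP => /eqP; lia.
Qed.

Definition chain_graph : multigraph := Multigraph card_chain_ends.

Definition inner_inc (u c : nat) : bool :=
  (u == inner_end1 c) || (2 < c) && (u == inner_end2 c).
Definition outer_inc (t d : nat) : bool :=
  (t == outer_end1 d) || (t == outer_end2 d).

Implicit Types (i : 'I_n) (F : edge chain_graph -> nat).

Lemma eq_inord m (x : 'I_m.+1) y : y < m.+1 -> (x == inord y) = (x == y :> nat).
Proof. by move=> lt_y; rewrite -val_eqE /= inordK. Qed.

Lemma eq_inner i j (u w : 'I_9) :
  (inl (i, u) == inl (j, w) :> chain_vertex) = (i == j) && (u == w).
Proof. by []. Qed.

Lemma eq_outer (s t : 'I_n.+2) : (inr s == inr t :> chain_vertex) = (s == t).
Proof. by []. Qed.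

Lemma sum_chain_edge F :
  \sum_e F e = \sum_i \sum_(0 <= c < 15) F (inl (i, inord c)) + \sum_d F (inr d).
Proof.
rewrite big_sumType /=; congr (_ + _).
transitivity (\sum_(p : 'I_n * 'I_15) F (inl (p.1, p.2))).
  by apply: eq_bigr => -[].
rewrite -(pair_bigA _ (fun i c => F (inl (i, c)))) /=.
apply: eq_bigr => i _; rewrite big_mkord.
by apply: eq_bigr => c _; rewrite inord_val.
Qed.

Lemma sum_chain_inner F i (u : 'I_9) :
  \sum_e F e * (inl (i, u) \in ends e) =
  \sum_(0 <= c < 15) F (inl (i, inord c)) * inner_inc u c.
Proof.
rewrite sum_chain_edge [X in _ + X]big1 => [|d _]; last by rewrite !inE muln0.
rewrite addn0 (bigD1 i) //= [X in _ + X]big1 ?addn0 => [|j nji].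
  apply: eq_big_nat => c /andP[_ c_lt]; congr (_ * nat_of_bool _).
  have /and3P[lt1 lt2 _] := inner_end_lt c_lt.
  rewrite !inE /= inordK // /inner_inc eq_inner eqxx eq_inord // ltnNge.
  congr (_ || _); case: leqP lt2 => //= _ lt2.
  by rewrite eq_inner eqxx eq_inord.
have nij : (i == j) = false by rewrite eq_sym (negPf nji).
apply: big1_seq => c _; rewrite !inE /= eq_inner nij.
by case: ifP => _; rewrite ?eq_inner ?nij muln0.
Qed.

Lemma sum_chain_outer F (t : 'I_n.+2) :
  \sum_e F e * (inr t \in ends e) =
  \sum_i \sum_(0 <= c < 15) F (inl (i, inord c)) * ((c < 3) && (t == i + c :> nat))
  + \sum_(d < 3) F (inr d) * outer_inc t d.
Proof.
rewrite sum_chain_edge; congr (_ + _); apply: eq_bigr.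
  move=> i _; apply: eq_big_nat => c /andP[_ c_lt]; congr (_ * nat_of_bool _).
  rewrite !inE /= inordK //; case: ifP => //= c_lt3.
  have lt_ic : i + c < n.+2 by have := ltn_ord i; lia.
  by rewrite eq_outer eq_inord.
move=> d _; congr (_ * nat_of_bool _); rewrite !inE /=.
have /andP[lt1 lt2] := outer_end_lt d.
by rewrite !eq_outer !eq_inord.
Qed.

Lemma sum_position (s c : nat) : \sum_(i < n) (s == i + c) = (c <= s < c + n).
Proof.
have [/andP[le_cs lt_s] | out_s] := boolP (c <= s < c + n); last first.
  by apply: big1 => i _; have := ltn_ord i; lia.
have lt_n : s - c < n by lia.
rewrite (bigD1 (Ordinal lt_n)) //= subnK // eqxx big1 // => i.
by rewrite -val_eqE /=; lia.
Qed.

Lemma cubic_chain_graph : cubic chain_graph.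
Proof.
move=> v; rewrite degreeE; transitivity (\sum_e 1 * (v \in @ends chain_graph e)).
  by apply: eq_bigr => e _; rewrite mul1n.
case: v => [[i u] | t].
  rewrite (sum_chain_inner (fun=> 1)) sum_iota0.
  apply/eqP; move: (nat_of_ord u) (ltn_ord u).
  by apply: all_iota0; vm_compute.
rewrite (sum_chain_outer (fun=> 1)).
under eq_bigr do rewrite sum_iota0 /= !mul1n !addn0.
under [X in _ + X]eq_bigr do rewrite mul1n.
have pos0 : \sum_(i < n) (t == i :> nat) = (t < n).
  by rewrite -[RHS](sum_position t 0); apply: eq_bigr => i _; rewrite addn0.
rewrite !big_split /= pos0 !sum_position 3?big_ord_recl big_ord0 /outer_inc /=.
have := ltn_ord t; rewrite /outer_end1 /outer_end2 /bump /=; lia.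
Qed.

(* Restricted to a Petersen graph minus a vertex, kinds 0, 1, 2 are three perfect
   matchings of the Petersen graph, one through each edge at the deleted vertex;
   kinds 3 and 4 use all three of these edges and every second edge of the
   6-cycle.  The sum of the first three and kind 4 exceeds kind 3 by the
   all-one vector. *)
Definition kind (q c : nat) : bool :=
  c \in nth [::] [:: [:: 0; 4; 5; 12; 14]; [:: 1; 3; 8; 10; 12];
    [:: 2; 6; 7; 10; 14]; [:: 0; 1; 2; 10; 12; 14]; [:: 0; 1; 2; 9; 11; 13]] q.

Definition chain_set (q : 'I_n -> nat) (D : pred nat) : {set edge chain_graph} :=
  [set e : chain_edge | match e with inl p => kind (q p.1) p.2 | inr d => D d end].

Lemma chain_set_inner q D i c :
  c < 15 -> (inl (i, inord c) \in chain_set q D) = kind (q i) c.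
Proof. by move=> lt_c; rewrite inE /= inordK. Qed.

(** Inside a Petersen part all five kinds cover each vertex once, by computation; only the vertices
    r_t need a hypothesis. *)
Lemma perfect_matching_chain_set (q : 'I_n -> nat) (D : pred nat) :
    (forall i, q i < 5) ->
    (forall t, t < n.+2 ->
      \sum_i (kind (q i) 0 * (t == i + 0) + kind (q i) 1 * (t == i + 1)
                + kind (q i) 2 * (t == i + 2))
      + \sum_(d < 3) D d * outer_inc t d = 1) ->
  perfect_matching (chain_set q D).
Proof.
move=> q_lt outer1; apply/perfect_matchingP => -[[i u] | t].
  rewrite (sum_chain_inner (fun e => e \in _)).
  under eq_big_nat => c /andP[_ c_lt] do rewrite chain_set_inner //.
  rewrite sum_iota0; apply/eqP; move: (q i) (q_lt i) (nat_of_ord u) (ltn_ord u).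
  pose ok k v := sumn [seq kind k c * inner_inc v c | c <- iota 0 15] == 1.
  move=> k k_lt; apply: (@all_iota0 (ok k)); move: k k_lt.
  by apply: (@all_iota0 (fun k => all (ok k) (iota 0 9))); vm_compute.
rewrite (sum_chain_outer (fun e => e \in _)).
apply: etrans (outer1 t (ltn_ord t)); congr (_ + _).
  apply: eq_bigr => i _.
  under eq_big_nat => c /andP[_ c_lt] do rewrite chain_set_inner //.
  by rewrite sum_iota0 /= !muln0 !addn0 addnA.
by apply: eq_bigr => d _; rewrite inE.
Qed.

(** * Upper bound: explicit matchings *)

Definition base_matching (s : nat) := chain_set (fun=> s) (pred1 s).

Definition triple_matching (x j : nat) :=
  chain_set (fun i => if i < j then 0 else if i == j :> nat then x else 2) pred0.

(** Part [i] is joined to r_{i+s}, and the two vertices r_t missed by all parts are the ends of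
    outer edge [s]. *)
Lemma perfect_matching_base (s : 'I_3) : perfect_matching (base_matching s).
Proof.
apply: perfect_matching_chain_set => [i | t lt_t].
  by apply: ltn_trans (ltn_ord s) _.
case: s => s lt_s; rewrite !big_split /= -!big_distrr /= !sum_position.
rewrite 3?big_ord_recl big_ord0 /outer_inc /outer_end1 /outer_end2 /bump /=.
by move: s lt_s => [|[|[|//]]] _ /=; lia.
Qed.

Lemma perfect_matching_triple x (j : 'I_n) :
  x \in [:: 3; 4] -> perfect_matching (triple_matching x j).
Proof.
move=> x34; have x_cross c : c < 3 -> kind x c.
  by move: x34; rewrite !inE => /orP[]/eqP->; case: c => [|[|[|]]].
apply: perfect_matching_chain_set => [i | t lt_t].
  by do 2!case: ifP => // _; move: x34; rewrite !inE => /orP[]/eqP->.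
rewrite [X in _ + X]big1 ?addn0 //.
(* The part joined to r_t: [j] takes r_j, r_{j+1}, r_{j+2}, and later parts are shifted by two. *)
pose p := if t < j then t else if t <= j + 2 then j : nat else t - 2.
have lt_p : p < n by have := ltn_ord j; rewrite /p; do 2?case: ifP; lia.
transitivity (\sum_(i < n) (p == i + 0) : nat); last by rewrite sum_position lt_p.
apply: eq_bigr => i _; rewrite /p.
by case: (ltngtP i j) => // [||->]; rewrite ?x_cross /kind //=;
  case: (ltnP t j); case: (leqP t (j + 2)); lia.
Qed.

Lemma classI_after_chain : classI_after chain_graph n.
Proof.
pose M := [ffun i : 'I_n => triple_matching 3 i].
have pmM i : perfect_matching (M i) by rewrite ffunE perfect_matching_triple.
apply/existsP; exists M; apply/andP; split; first exact/forallP.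
apply/(classI_add_edge_sets (inr ord0 : vertex chain_graph)) => //.
  exact: cubic_chain_graph.
(* The three base matchings, and each added matching with kind 3 replaced by kind 4. *)
exists (fun j => match split j with
                 | inl s => base_matching s
                 | inr i => triple_matching 4 i
                 end) => [j | e].
  case: (split j) => [s | i]; first exact: perfect_matching_base.
  exact: perfect_matching_triple.
rewrite big_split_ord /=.
under eq_bigr do rewrite (unsplitK (inl _)).
under [X in _ + X = _]eq_bigr do rewrite (unsplitK (inr _)).
under [X in _ = _ + X]eq_bigr do rewrite ffunE.
case: e => [[i c] | d]; last first.
  rewrite [X in _ + X = _]big1 => [|j _]; last by rewrite inE.
  rewrite [X in _ = _ + X]big1 => [|j _]; last by rewrite inE.
  rewrite (bigD1 d) //= inE /= eqxx big1 // => s nsd.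
  by rewrite inE /= val_eqE eq_sym (negPf nsd).
(* At part [i] the two triple matchings of index [j] differ only if [j] is [i]; what remains is the
   identity between the kinds. *)
rewrite (bigD1 i) //= [in RHS](bigD1 i) //= !addnA; congr (_ + _); last first.
  by apply: eq_bigr => j nji; rewrite !inE /= val_eqE eq_sym (negPf nji).
rewrite 3?big_ord_recl big_ord0 !inE /= ltnn eqxx.
apply/eqP; move: (nat_of_ord c) (ltn_ord c).
by apply: all_iota0; vm_compute.
Qed.

(** * Lower bound: parity in the Petersen parts *)

Implicit Types S : {set edge chain_graph}.

Definition cut_count S i := \sum_(0 <= c < 3) (inl (i, inord c) \in S).

(** A part has nine vertices, hence the odd count. If one edge leaves, two of the vertices 0, 1, 2
    are matched into the 6-cycle. Their partners are not antipodal, and at distance two they would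
    isolate a vertex, so they are adjacent. The other four cycle vertices form a path matched by its
    end edges, which lie both in 10, 12, 14 or both outside. *)
Lemma cut_petersen S i (pmS : perfect_matching S) :
  odd (cut_count S i) /\
  (cut_count S i <= 1 ->
   ~~ odd (\sum_(c <- [:: 10; 12; 14]) (inl (i, inord c) \in S))).
Proof.
move/perfect_matchingP in pmS; pose m c := inl (i, inord c) \in S.
have {}pmS u : u < 9 -> \sum_(0 <= c < 15) m c * inner_inc u c = 1.
  move=> lt_u; apply: etrans (pmS (inl (i, Ordinal lt_u))).
  by rewrite (sum_chain_inner (fun e => e \in S)).
have {pmS} := (pmS 0 isT, pmS 1 isT, pmS 2 isT, pmS 3 isT, pmS 4 isT, pmS 5 isT,
  pmS 6 isT, pmS 7 isT, pmS 8 isT).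
rewrite !sum_iota0 /inner_inc /= !muln0 !muln1 !add0n !addn0.
rewrite /cut_count sum_iota0 -/(m _) !big_cons big_nil.
rewrite /= -!/(m _).
move: (m 0) (m 1) (m 2) (m 3) (m 4) (m 5) (m 6) (m 7) (m 8) (m 9) (m 10) (m 11)
  (m 12) (m 13) (m 14).
move=> m0 m1 m2 m3 m4 m5 m6 m7 m8 m9 m10 m11 m12 m13 m14.
move=> [[[[[[[[e0 e1] e2] e3] e4] e5] e6] e7] e8].
(* Branching round the 6-cycle lets the equation at each vertex prune cases early. *)
case: m3 e0 e3; case: m9 e4 => e4 e0 // e3; case: m14 e3 e8 => // _ e8;
  case: m4 e1 e4 => // e1; case: m10 e5 => //= e5 _; case: m5 e2 e5 => // e2;
  case: m11 e6 => //= e6 _; case: m6 e0 e6 => // e0; case: m12 e7 => //= e7 _;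
  case: m7 e1 e7 => // e1; case: m13 e8 => //= e8 _; case: m8 e2 e8 => // e2 _;
  by case: m0 e0; case: m1 e1; case: m2 e2.
Qed.

Lemma cut_count_gt0 S i : perfect_matching S -> 0 < cut_count S i.
Proof. by move=> pmS; have [/odd_gt0] := cut_petersen i pmS. Qed.

(** Edges of [S] that leave parts end at distinct vertices r_t. *)
Lemma sum_cut_count S : perfect_matching S -> \sum_i cut_count S i <= n.+2.
Proof.
move/perfect_matchingP => pmS.
have {pmS} outer1 (t : 'I_n.+2) : \sum_i \sum_(0 <= c < 3)
    (inl (i, inord c) \in S) * (t == i + c :> nat) <= 1.
  apply: leq_trans (eq_leq (pmS (inr t))).
  rewrite (sum_chain_outer (fun e => e \in S)) (leq_trans _ (leq_addr _ _)) //.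
  by apply: leq_sum => i _; rewrite !sum_iota0 /= !muln0 !addn0 addnA.
rewrite -[n.+2 in leqRHS]card_ord -sum1_card.
apply: leq_trans (leq_sum _ (fun t _ => outer1 t)).
rewrite [leqRHS]exchange_big; apply: leq_sum => i _; rewrite [leqRHS]exchange_big.
rewrite /cut_count big_nat [leqRHS]big_nat; apply: leq_sum => c /andP[_ c_lt].
have lt_ic : i + c < n.+2 by have := ltn_ord i; lia.
by rewrite (bigD1 (Ordinal lt_ic)) //= eqxx muln1 leq_addr.
Qed.

Lemma triple_cut_uniq S i j : perfect_matching S ->
  1 < cut_count S i -> 1 < cut_count S j -> i = j.
Proof.
move=> pmS gt1_i gt1_j; apply/eqP; apply: contraTT (sum_cut_count pmS) => nij.
have ge3 x : 1 < cut_count S x -> 3 <= cut_count S x.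
  by have [] := cut_petersen x pmS; case: cut_count => [|[|[|]]].
(* The total excess over one edge per part is at most 2, while a part using three edges contributes
   2 by itself. *)
have -> : \sum_i cut_count S i = n + \sum_i (cut_count S i).-1.
  rewrite -[n in n + _]card_ord -sum1_card -big_split; apply: eq_bigr => x _.
  by rewrite /= add1n prednK // cut_count_gt0.
rewrite (bigD1 i) // (bigD1 j) 1?eq_sym //=.
by have := ge3 i gt1_i; have := ge3 j gt1_j; lia.
Qed.

Lemma chain_lower_bound k : classI_after chain_graph k -> n <= k.
Proof.
case/existsP => M /andP[/forallP pmM].
case/(classI_add_edge_sets (inr ord0 : vertex chain_graph) cubic_chain_graph pmM).
move=> N pmN sumN.
have weighted i (s : seq nat) :
    \sum_j \sum_(c <- s) (inl (i, inord c) \in N j) =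
    size s + \sum_a \sum_(c <- s) (inl (i, inord c) \in M a).
  rewrite exchange_big (eq_bigr _ (fun c _ => sumN _)) big_split.
  by rewrite sum1_size exchange_big.
have tripled i : [exists a, 1 < cut_count (M a) i].
  apply: contraT; rewrite negb_exists => /forallP le1M.
  have cutM a : cut_count (M a) i = 1.
    by apply/eqP; rewrite eqn_leq leqNgt le1M cut_count_gt0.
  (* The [3 + k] matchings [N j] use [3 + k] leaving edges in total and at least one each. *)
  have cutN : (fun=> 1) =1 (fun j => cut_count (N j) i).
    apply: eq_leq_sum => [j|]; first exact: cut_count_gt0.
    rewrite sum1_card card_ord weighted; congr (_ + _).
    by rewrite (eq_bigr _ (fun a _ => cutM a)) sum1_card card_ord.
  (* Over the edges 10, 12, 14 the left side is even, but the right side is 3 plus an even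
     number. *)
  have := congr1 odd (weighted i [:: 10; 12; 14]).
  rewrite oddD /=.
  have even_sum (I : finType) (F : I -> nat) :
      (forall x, ~~ odd (F x)) -> odd (\sum_x F x) = false.
    move=> evF; apply/negbTE; elim/big_ind: _ => // x y.
    by rewrite oddD => /negbTE-> /negbTE->.
  rewrite !even_sum // => x; apply: (proj2 (cut_petersen i _)) => //.
    by rewrite cutM.
  by rewrite -cutN.
(* Each part picks an added matching using all three of its leaving edges; no matching is picked
   twice. *)
pose f i := xchoose (existsP (tripled i)).
have f_inj : injective f.
  move=> i j eq_f; apply: (triple_cut_uniq (pmM (f i))).
    exact: (xchooseP (existsP (tripled i))).
  by rewrite eq_f; apply: (xchooseP (existsP (tripled j))).
by have := leq_card f f_inj; rewrite !card_ord.
Qed.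

End ChainGraph.

Theorem corollary3p9 (n : nat) (hn : 0 < n) :
  exists H : multigraph, cubic H /\ l H = Some n.
Proof.
exists (chain_graph n); split; first exact: cubic_chain_graph.
rewrite /l; case: boolp.pselect => [ex | []]; last first.
  by exists n; apply: classI_after_chain.
case: ex_minnP => m /chain_lower_bound le_nm min_m; congr Some; apply/eqP.
by rewrite eqn_leq le_nm min_m // classI_after_chain.
Qed.
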